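(* Let $r_1,r_2,m_1,m_2>0$ with $m_1+m_2=1$, $r_1=m_2$ and $r_2=m_1$ (and therefore $r_1+r_2=1$), and let $\mu$ be the self-similar measure on $[0,1]$ determined by $S_1(x)=r_1x$, $S_2(x)=r_2x+1-r_2$ and weights $(m_1,m_2)$. Then the positive eigenvalues of $-\frac{d}{d\mu}\frac{d}{dx}$ with Neumann boundary conditions coincide with the eigenvalues of $-\frac{d}{d\mu}\frac{d}{dx}$ with Dirichlet boundary conditions.
   Context: The self-similar measure $\mu$ is the unique Borel probability measure on $[0,1]$ with $\mu(B)=m_1\,\mu(S_1^{-1}(B))+m_2\,\mu(S_2^{-1}(B))$ for all Borel sets $B$ (it is non-atomic). Derivatives with respect to a measure: for a non-atomic Borel probability measure $\nu$ on $[0,1]$ and $f\colon[0,1]\to\mathbb{R}$, $h\in L_2([0,1],\nu)$ is the $\nu$-derivative $\frac{df}{d\nu}$ of $f$ if $f(x)=f(0)+\int_0^x h\,d\nu$ for all $x\in[0,1]$ (unique in $L_2(\nu)$). $H^1(\nu)$ is the space of functions possessing a $\nu$-derivative; such functions are continuous. For Lebesgue measure the derivative is written $f'$ or $\frac{df}{dx}$. $H^2(\lambda,\mu)$ (index $\lambda$: Lebesgue measure) is the space of all $f$ possessing a Lebesgue derivative $f'$ (that is, $f'$ is square-integrable with respect to Lebesgue measure and $f(x)=f(0)+\int_0^x f'(t)\,dt$ for all $x\in[0,1]$) belonging to $H^1(\mu)$ (so $f'$ is taken continuous). A real number $\Lambda$ is an eigenvalue with Neumann (respectively Dirichlet) boundary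 conditions if there is a non-zero $f\in H^2(\lambda,\mu)$ with $\frac{d}{d\mu}f'=-\Lambda f$ and $f'(0)=f'(1)=0$ (respectively $f(0)=f(1)=0$). *)

(* Defs.v *)
From HB Require Import structures.
From mathcomp Require Import all_boot all_order all_algebra.
From mathcomp Require Import all_classical all_reals all_analysis.
Set Implicit Arguments.
Unset Strict Implicit.
Unset Printing Implicit Defensive.
Import Order.TTheory GRing.Theory Num.Theory.
Import numFieldNormedType.Exports.
Local Open Scope classical_set_scope.
Local Open Scope ring_scope.

(* Functions on [0,1] are represented by functions R -> R of which only the
   values on [0,1] matter; measures on [0,1] by Borel measures on R, used only
   through their restriction to [0,1]. *)

(* h is in L_2([0,1], nu); outside [0,1], h is replaced by 0. *)
Definition L2 (R : realType) (nu : {measure set (measurableTypeR R) -> \bar R})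
    (h : R -> R) : Prop :=
  (h \_ `[0, 1]) \in Lfun nu 2%:E.

(* The derivative is only determined nu-almost everywhere: h is one of its
   representatives. *)
Definition is_derivative_wrt (R : realType)
    (nu : {measure set (measurableTypeR R) -> \bar R}) (f h : R -> R) : Prop :=
  L2 nu h /\
  forall x : R, x \in `[0, 1] -> f x = f 0 + \int[nu]_(t in `[0, x]) h t.

Definition H1 (R : realType) (nu : {measure set (measurableTypeR R) -> \bar R})
    (f : R -> R) : Prop :=
  exists h, is_derivative_wrt nu f h.

(* f is in H^2(lambda, mu) and f' is the representative of its Lebesgue
   derivative lying in H^1(mu). This representative is pinned down at every
   point of [0,1] when mu is non-atomic, since f' is then continuous there. *)
Definition H2 (R : realType) (mu : {measure set (measurableTypeR R) -> \bar R})
    (f f' : R -> R) : Prop :=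
  is_derivative_wrt lebesgue_measure f f' /\ H1 mu f'.

Definition eigenfunction (R : realType)
    (mu : {measure set (measurableTypeR R) -> \bar R}) (L : R)
    (f f' : R -> R) : Prop :=
  [/\ exists2 x : R, x \in `[0, 1] & f x != 0,
      H2 mu f f' &
      is_derivative_wrt mu f' (fun x => - L * f x)].

Definition neumann_eigenvalue (R : realType)
    (mu : {measure set (measurableTypeR R) -> \bar R}) (L : R) : Prop :=
  exists f f', [/\ eigenfunction mu L f f', f' 0 = 0 & f' 1 = 0].

Definition dirichlet_eigenvalue (R : realType)
    (mu : {measure set (measurableTypeR R) -> \bar R}) (L : R) : Prop :=
  exists f f', [/\ eigenfunction mu L f f', f 0 = 0 & f 1 = 0].

Definition S1 (R : realType) (r1 : R) (x : R) : R := r1 * x.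
Definition S2 (R : realType) (r2 : R) (x : R) : R := r2 * x + 1 - r2.

(* The preimages are taken in R instead of [0,1]; this does not change their
   measure, as mu vanishes outside [0,1]. *)
Definition self_similar (R : realType) (r1 r2 m1 m2 : R)
    (mu : {measure set (measurableTypeR R) -> \bar R}) : Prop :=
  mu `[0, 1]%classic = 1%E /\
  forall B : set (measurableTypeR R), measurable B ->
    mu B = (m1%:E * mu (S1 r1 @^-1` B) + m2%:E * mu (S2 r2 @^-1` B))%E.

(* Main.v *)
Require Import Defs.
From HB Require Import structures.
From mathcomp Require Import all_boot all_order all_algebra.
From mathcomp Require Import all_classical all_reals all_analysis.
From mathcomp Require Import measurable_realfun lra ring.
Set Implicit Arguments.
Unset Strict Implicit.
Unset Printing Implicit Defensive.
Import Order.TTheory GRing.Theory Num.Theory.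
Import numFieldNormedType.Exports.
Local Open Scope classical_set_scope.
Local Open Scope ring_scope.

(* Let phi x = mu ]x, 1].  When the weights are the contraction ratios in the
   opposite order, phi is an involution of [0,1] that exchanges mu and Lebesgue
   measure.  Composing with phi thus exchanges the two equations df = f' dx and
   df' = - L f dmu, up to signs: if f is an eigenfunction for L > 0, so is
   f' o phi, with Lebesgue derivative L (f o phi).  The Neumann conditions on f
   are the Dirichlet conditions on f' o phi, and conversely.  Dirichlet
   eigenvalues are positive since int f'^2 dx = L int f^2 dmu. *)

(** * Square-integrable functions and derivatives with respect to a finite measure *)

Section L2.
Context (R : realType) (nu : {measure set (measurableTypeR R) -> \bar R}).
Implicit Types h : R -> R.

(** Unfolds [Lfun] at exponent 2 into an integral of squares, the form in which changes of variables
    apply. Measurability concerns only the extension of [h] by 0. *)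
Lemma L2P h : L2 nu h <->
  measurable_fun [set: measurableTypeR R] (h \_ `[0, 1]) /\
  (\int[nu]_(x in `[0%R, 1%R]) (h x ^+ 2)%:E < +oo)%E.
Proof.
have sqE : (\int[nu]_(x in `[0%R, 1%R]) (h x ^+ 2)%:E =
    \int[nu]_x (`|(h \_ `[0%R, 1%R]) x| `^ 2)%:E)%E.
  rewrite integral_mkcond; apply: eq_integral => x _.
  rewrite powR_mulrn// real_normK ?num_real//.
  by rewrite !patchE; case: ifPn => //; rewrite expr0n.
rewrite /L2 sqE; split=> [h2|[mh h2]].
  split; first by move: h2; rewrite inE => /andP[/[!inE]].
  have : nu.-integrable setT (fun x => (`|(h \_ `[0, 1]) x| `^ 2)%:E).
    by apply: Lfun_integrable => //; rewrite ler1n.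
  move=> /integrableP[_].
  by under eq_integral do rewrite gee0_abs ?lee_fin ?powR_ge0//.
rewrite inE; apply/andP; split; rewrite inE//= /finite_norm unlock /Lnorm.
by rewrite poweR_lty.
Qed.

Lemma L2_integrable h : (nu `[0%R, 1%R]%classic < +oo)%E -> L2 nu h ->
  nu.-integrable `[0, 1] (EFin \o h).
Proof.
move=> nu_fin /L2P[mh h2].
have m01 : measurable (`[0, 1]%classic : set (measurableTypeR R)).
  exact: measurable_itv.
have mh' : measurable_fun (`[0, 1] : set (measurableTypeR R)) h.
  exact/measurable_restrictT.
(* The bound [|h| <= 1 + h ^+ 2] dominates [h] by a function that is integrable because [nu] is
   finite on [0,1]. *)
apply: (@le_integrable _ _ _ nu _ m01 _ (fun x => (1 + h x ^+ 2)%:E)).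
- exact/measurable_EFinP.
- move=> x _ /=.
  rewrite lee_fin [leRHS]ger0_norm; last by rewrite addr_ge0 ?sqr_ge0.
  by rewrite ler_norml; apply/andP; split; nra.
- rewrite (_ : (fun _ => _) = (cst 1%E \+ (fun x => (h x ^+ 2)%:E))%E)//.
  apply: integrableD => //.
    by apply/integrableP; split=> //; rewrite integral_cst//= normr1 mul1e.
  apply/integrableP; split; first exact/measurable_EFinP/measurable_funX.
  by under eq_integral do rewrite gee0_abs ?lee_fin ?sqr_ge0//.
Qed.

Lemma L2_integrableS h (A : set (measurableTypeR R)) :
  (nu `[0%R, 1%R]%classic < +oo)%E -> L2 nu h ->
  measurable A -> A `<=` `[0, 1] ->
  nu.-integrable A (EFin \o h).
Proof.
move=> nu_fin h2 mA AI.
have m01 : measurable (`[0, 1]%classic : set (measurableTypeR R)).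
  exact: measurable_itv.
by apply: (integrableS m01 mA AI); exact: L2_integrable.
Qed.

Lemma L2Z (c : R) h : L2 nu h -> L2 nu (fun x => c * h x).
Proof.
move=> /L2P[mh h2]; apply/L2P; split.
  rewrite (_ : _ \_ _ = (fun x => c * (h \_ `[0, 1]) x)).
    exact: (measurable_funM (measurable_cst c) mh).
  by apply/funext => x; rewrite !patchE; case: ifPn; rewrite ?mulr0.
under eq_integral do rewrite exprMn EFinM.
rewrite ge0_integralZl//.
- by rewrite lte_mul_pinfty// ?lee_fin ?sqr_ge0.
- apply/measurable_EFinP/measurable_funX.
  by apply/measurable_restrictT => //; exact: measurable_itv.
- by move=> x _; rewrite lee_fin sqr_ge0.
- by rewrite lee_fin sqr_ge0.
Qed.

End L2.

Lemma lebesgue_measure01_lty (R : realType) :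
  ((lebesgue_measure : {measure set (measurableTypeR R) -> \bar R})
    `[0%R, 1%R]%classic < +oo)%E.
Proof.
have := @lebesgue_measure_itv R `[0, 1].
rewrite /= lte01 oppr0 adde0 => e.
by apply: (@le_lt_trans _ _ 1%E); [rewrite -e | exact: ltry].
Qed.

(** The reflection reverses order and turns integrals starting at 0 into integrals ending at 1. The
    left end is open so that the splitting of [0,1] at [x] is disjoint and holds for any measure,
    with or without atoms. *)
Lemma is_derivative_wrt_tail (R : realType)
    (nu : {measure set (measurableTypeR R) -> \bar R}) (f h : R -> R) (x : R) :
  (nu `[0%R, 1%R]%classic < +oo)%E ->
  is_derivative_wrt nu f h -> x \in `[0, 1] ->
  f 1 - f x = \int[nu]_(t in `]x, 1]) h t.
Proof.
move=> nu_fin [h2 fE] x01.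
have [x0 x1] : 0 <= x /\ x <= 1 by move: x01; rewrite in_itv/= => /andP.
rewrite (fE x)// (fE 1) ?in_itv/= ?ler01 ?lexx// opprD addrACA subrr add0r.
have UE :
  `[0, 1]%classic = `[0, x]%classic `|` `]x, 1]%classic :> set (measurableTypeR R).
  by apply: itv_bndbnd_setU; rewrite bnd_simp.
have mitv (i : interval R) : measurable ([set` i] : set (measurableTypeR R)).
  exact: measurable_itv.
rewrite UE Rintegral_setU//.
- by rewrite addrAC subrr add0r.
- by rewrite -UE; exact: L2_integrable.
- apply/disj_setPS => t /= []; rewrite !in_itv/= => /andP[_ tx] /andP[].
  by rewrite ltNge tx.
Qed.

Lemma is_derivative_wrtZ (R : realType)
    (nu : {measure set (measurableTypeR R) -> \bar R}) (c : R) (f h : R -> R) :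
  (nu `[0%R, 1%R]%classic < +oo)%E ->
  is_derivative_wrt nu f h ->
  is_derivative_wrt nu (fun x => c * f x) (fun x => c * h x).
Proof.
move=> nu_fin [h2 fE]; split=> [|x x01]; first exact: L2Z.
have mx : measurable (`[0, x]%classic : set (measurableTypeR R)).
  exact: measurable_itv.
rewrite RintegralZl//; first by rewrite fE// mulrDr.
apply: L2_integrableS => //; apply: subset_itvl; rewrite bnd_simp.
by move: x01; rewrite in_itv => /andP[].
Qed.

(** * The tail function of the measure and the reflection built from it *)

Definition tail (R : realType) (mu : probability (measurableTypeR R) R)
    (x : R) : R := fine (mu `]x, +oo[%classic).

Lemma tail_ge0 (R : realType) (mu : probability (measurableTypeR R) R) x :
  0 <= tail mu x.
Proof. by rewrite fine_ge0. Qed.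

Lemma tail_le1 (R : realType) (mu : probability (measurableTypeR R) R) x :
  tail mu x <= 1.
Proof. by rewrite -lee_fin fineK ?fin_num_measure// probability_le1. Qed.

Lemma tail_antitone (R : realType) (mu : probability (measurableTypeR R) R) :
  nonincreasing_fun (tail mu).
Proof.
move=> x y xy; rewrite fine_le ?fin_num_measure//.
rewrite le_measure ?inE// => z /=; rewrite !in_itv/= !andbT.
exact: le_lt_trans.
Qed.

(* The values outside [0, 1] are chosen so that [reflection mu] is an antitone
   involution of the whole line. *)
Definition reflection (R : realType) (mu : probability (measurableTypeR R) R)
    (x : R) : R :=
  if x \in `[0, 1] then tail mu x else 1 - x.

Section self_similar_reflection.
Context (R : realType) (r1 r2 : R).
Hypotheses (r1_gt0 : 0 < r1) (r2_gt0 : 0 < r2) (r1Dr2 : r1 + r2 = 1).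
Variable mu : probability (measurableTypeR R) R.
Hypothesis mu_ss : self_similar r1 r2 r2 r1 mu.

(** Self-similarity evaluated on a half-line. Half-lines are used rather than []x, 1]] because their
    preimages under [S1] and [S2] are again half-lines. The weight attached to each contraction is
    the ratio of the other one. *)
Lemma tailE x :
  tail mu x = r2 * tail mu (x / r1) + r1 * tail mu ((x - r1) / r2).
Proof.
rewrite /tail (mu_ss.2 `]x, +oo[%classic)//.
rewrite (_ : S1 r1 @^-1` `]x, +oo[ = `]x / r1, +oo[%classic); last first.
  apply/seteqP; split=> t /=.
    by rewrite !in_itv/= !andbT /S1 ltr_pdivrMr// mulrC.
  by rewrite !in_itv/= !andbT /S1 ltr_pdivrMr// mulrC.
rewrite (_ : S2 r2 @^-1` `]x, +oo[ = `](x - r1) / r2, +oo[%classic); last first.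
  have e (t : R) : (x < r2 * t + 1 - r2) = ((x - r1) / r2 < t).
    by rewrite ltr_pdivrMr//; move: r1Dr2 => ?; apply/idP/idP => ?; lra.
  by apply/seteqP; split=> t /=; rewrite !in_itv/= !andbT /S2 e.
by rewrite fineD ?fin_numM ?fin_num_measure// !fineM ?fin_num_measure.
Qed.

Lemma tail_lt0 x : x < 0 -> tail mu x = 1.
Proof.
move=> x0; apply/eqP; rewrite eq_le tail_le1/= -lee_fin.
rewrite fineK ?fin_num_measure// -mu_ss.1 le_measure ?inE// => z /=.
rewrite !in_itv/= !andbT => /andP[z0 _].
exact: lt_le_trans z0.
Qed.

Lemma tail_ge1 x : 1 <= x -> tail mu x = 0.
Proof.
move=> x1; apply/eqP; rewrite eq_le tail_ge0 andbT.
have mu01 : mu `[0, 1]%classic = 1%E := mu_ss.1.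
have muU : (mu (`]x, +oo[ `|` `[0%R, 1%R])%classic =
    mu `]x, +oo[%classic + mu `[0%R, 1%R]%classic)%E.
  apply: measureU => //.
  apply/seteqP; split=> // t /=; rewrite !in_itv/= => -[+ /andP[_ t1]].
  by rewrite ltNge (le_trans t1).
have : (mu (`]x, +oo[ `|` `[0%R, 1%R])%classic <= 1)%E.
  by apply: probability_le1; apply: measurableU.
rewrite muU mu01 /tail -{1}[mu _]fineK ?fin_num_measure//.
by rewrite -EFinD lee_fin -lerBrDr subrr.
Qed.

(** This says that 0 is not an atom. In [tailE] at 0 the second argument is negative, so that
    [tail mu 0 = r2 * tail mu 0 + r1], and [1 - r2 = r1 > 0]. *)
Lemma tail0 : tail mu 0 = 1.
Proof.
have := tailE 0; rewrite mul0r (@tail_lt0 ((0 - r1) / r2)).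
  move=> e.
  have : r1 * (tail mu 0 - 1) = 0 by move: r1Dr2 => ?; nra.
  by move/eqP; rewrite mulf_eq0 gt_eqF//= => /eqP; lra.
by rewrite sub0r mulNr oppr_lt0 divr_gt0.
Qed.

(** The second term of [tailE] is taken at a point [<= 0], where the tail is 1; for [t = 1] that
    point is 0, whence [tail0]. As [r1 = 1 - r2], the right-hand side is [S2 r2 (tail mu t)]: this
    is where the exchanged weights matter. *)
Lemma tail_S1 t : t <= 1 -> tail mu (S1 r1 t) = r2 * tail mu t + r1.
Proof.
move: (r1_gt0) (r2_gt0) (r1Dr2) => r1p r2p r12.
move=> t1; rewrite tailE /S1 [_ / r1]mulrC mulKf ?gt_eqF//.
suff -> : tail mu ((r1 * t - r1) / r2) = 1 by rewrite mulr1.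
have : (r1 * t - r1) / r2 <= 0.
  rewrite ler_pdivrMr// mul0r; nra.
by rewrite le_eqVlt => /predU1P[->|/tail_lt0//]; exact: tail0.
Qed.

(** Now the first term of [tailE] vanishes, being taken at a point [>= 1]; the right-hand side is
    [S1 r1 (tail mu t)]. *)
Lemma tail_S2 t : 0 <= t -> tail mu (S2 r2 t) = r1 * tail mu t.
Proof.
move: (r1_gt0) (r2_gt0) (r1Dr2) => r1p r2p r12.
move=> t0; rewrite tailE /S2 (@tail_ge1 (_ / r1)).
  rewrite mulr0 add0r; congr (_ * tail mu _).
  have -> : r2 * t + 1 - r2 - r1 = r2 * t by lra.
  by rewrite mulrC mulKf// gt_eqF.
by rewrite ler_pdivlMr//; nra.
Qed.

(* [tail] maps the image of [S1] to that of [S2] and conversely, so the defect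
   [D x = tail (tail x) - x] satisfies [D (S1 x) = r1 * D x] and
   [D (S2 x) = r2 * D x]; being bounded, it vanishes. *)
Lemma tail_involutive x : 0 <= x <= 1 -> tail mu (tail mu x) = x.
Proof.
move: (r1_gt0) (r2_gt0) (r1Dr2) => r1p r2p r12.
pose D x := tail mu (tail mu x) - x.
have DS1 t : 0 <= t <= 1 -> D (S1 r1 t) = r1 * D t.
  move=> /andP[t0 t1]; rewrite /D tail_S1//.
  have -> : r2 * tail mu t + r1 = S2 r2 (tail mu t) by rewrite /S2; lra.
  by rewrite tail_S2 ?tail_ge0// /S1; ring.
have DS2 t : 0 <= t <= 1 -> D (S2 r2 t) = r2 * D t.
  move=> /andP[t0 t1]; rewrite /D tail_S2//.
  have -> : r1 * tail mu t = S1 r1 (tail mu t) by rewrite /S1; lra.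
  rewrite tail_S1 ?tail_le1// /S2 (_ : r1 = 1 - r2); last lra; ring.
pose A := [set `|D t| | t in `[0, 1]].
have ubA : ubound A 1.
  move=> _ [t /= + <-]; rewrite in_itv/= => /andP[t0 t1].
  have := tail_ge0 mu (tail mu t); have := tail_le1 mu (tail mu t).
  by rewrite ler_norml /D => ? ?; apply/andP; split; lra.
have hsA : has_sup A.
  by split; [exists `|D 0|, 0; rewrite //= in_itv/= lexx ler01 | exists 1].
have leA t : 0 <= t <= 1 -> `|D t| <= sup A.
  by move=> t01; apply: sup_upper_bound => //; exists t => //=; rewrite in_itv.
have A0 : 0 <= sup A by apply: le_trans (leA 0 _); rewrite ?lexx ?ler01.
pose c := Num.max r1 r2.
have c1 : c < 1 by rewrite gt_max; apply/andP; split; lra.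
(* The images of [S1] and [S2] cover [0,1], so each [|D t|] is at most [c] times another value of
   [|D|]. Since [c < 1] and [sup A >= 0], the supremum is 0. *)
have supA : sup A <= c * sup A.
  apply: ge_sup; first exact: hsA.1.
  move=> _ [t /= + <-]; rewrite in_itv/= => /andP[t0 t1].
  have [tr1|r1t] := leP t r1.
    have t01 : 0 <= t / r1 <= 1.
      by rewrite divr_ge0 ?(ltW r1_gt0)//= ler_pdivrMr ?mul1r.
    have -> : t = S1 r1 (t / r1) by rewrite /S1 mulrC divfK// gt_eqF.
    rewrite DS1// normrM gtr0_norm//; apply: ler_pM => //; first exact: ltW.
      by rewrite le_max lexx.
    exact: leA.
  have t01 : 0 <= (t - r1) / r2 <= 1.
    rewrite divr_ge0 ?(ltW r2_gt0)//= ?ler_pdivrMr ?mul1r//; lra.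
  have -> : t = S2 r2 ((t - r1) / r2) by rewrite /S2 mulrC divfK ?gt_eqF//; lra.
  rewrite DS2// normrM gtr0_norm//; apply: ler_pM => //; first exact: ltW.
    by rewrite le_max lexx orbT.
  exact: leA.
move=> /leA; rewrite (_ : sup A = 0); last by nra.
by rewrite normr_le0 subr_eq0 => /eqP.
Qed.

Lemma reflection_in x : (reflection mu x \in `[0, 1]) = (x \in `[0, 1]).
Proof.
rewrite /reflection; case: ifPn => [_|].
  by rewrite in_itv/= tail_ge0 tail_le1.
rewrite !in_itv/= => /negbTE <-; rewrite subr_ge0 andbC; congr (_ && _).
by rewrite -subr_ge0 opprB addrCA subrr addr0.
Qed.

Lemma reflection_involutive : involutive (reflection mu).
Proof.
move=> x; rewrite {1}/reflection reflection_in /reflection.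
case: (boolP (x \in _)) => [|_]; last by rewrite subKr.
by rewrite in_itv/=; exact: tail_involutive.
Qed.

Lemma reflection_antitone : nonincreasing_fun (reflection mu).
Proof.
move=> x y xy; rewrite /reflection; case: ifPn => [|]; case: ifPn.
- by move=> _ _; exact: tail_antitone.
- rewrite !in_itv/= => xI yI.
  have := tail_le1 mu y; have := tail_ge0 mu y.
  move: xI; rewrite negb_and -!ltNge => /orP[]; lra.
- rewrite !in_itv/= => xI yI.
  have := tail_le1 mu x; have := tail_ge0 mu x.
  move: yI; rewrite negb_and -!ltNge => /orP[]; lra.
by move=> _ _; lra.
Qed.

(** An antitone involution is its own adjoint. This and the variants below compute preimages of
    intervals exactly, endpoints included. *)
Lemma le_reflection x y : (reflection mu x <= y) = (reflection mu y <= x).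
Proof.
by apply/idP/idP => /reflection_antitone; rewrite reflection_involutive.
Qed.

Lemma ge_reflection x y : (x <= reflection mu y) = (y <= reflection mu x).
Proof.
by apply/idP/idP => /reflection_antitone; rewrite reflection_involutive.
Qed.

Lemma gt_reflection x y : (x < reflection mu y) = (y < reflection mu x).
Proof. by rewrite !ltNge le_reflection. Qed.

Lemma reflection0 : reflection mu 0 = 1.
Proof. by rewrite /reflection in_itv/= lexx ler01 tail0. Qed.

Lemma reflection1 : reflection mu 1 = 0.
Proof. by rewrite -reflection0 reflection_involutive. Qed.

Lemma measurable_reflection : measurable_fun [set: measurableTypeR R]
  (reflection mu : measurableTypeR R -> measurableTypeR R).
Proof.
by apply: nonincreasing_measurable => //; exact: reflection_antitone.
Qed.

(** * Exchange of [mu] and Lebesgue measure by the reflection *)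

Let phi : measurableTypeR R -> measurableTypeR R := reflection mu.
Let mphi : measurable_fun [set: measurableTypeR R] phi := measurable_reflection.
HB.instance Definition _ := isMeasurableFun.Build _ _ _ _ phi mphi.
Let leb : {measure set (measurableTypeR R) -> \bar R} := lebesgue_measure.
Let I : set (measurableTypeR R) := `[0, 1]%classic.
Let mI : measurable I. Proof. exact: measurable_itv. Qed.

(** Open right half-lines are stable under intersection and generate the Borel sets, so two finite
    measures agreeing on them are equal. For [x] in [0,1[, [x < phi t] means [t < phi x], so the
    preimage of the half-line meets [0,1] in [[0, phi x[], of length [tail mu x]. *)
Lemma mu_reflection (A : set (measurableTypeR R)) : measurable A ->
  mu A = leb (phi @^-1` A `&` I).
Proof.
move=> mA.
have mE : @measurable _ (measurableTypeR R) = <<s RGenOInfty.G (R:=R) >>.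
  exact: RGenOInfty.measurableE.
apply: (@measure_unique _ R (measurableTypeR R) (@RGenOInfty.G R)
  (fun n => `](-n%:R), +oo[%classic) mE _ _ _ mu
  (pushforward (mrestr leb mI) phi)) => //.
- move=> _ _ [x ->] [y ->]; exists (Num.max x y).
  by apply/seteqP; split=> t /=; rewrite !in_itv/= !andbT gt_max => /andP.
- by move=> n; eexists.
- apply/seteqP; split=> // t _ /=.
  exists (Num.truncn (- t)).+1 => //=.
  by rewrite in_itv/= andbT ltrNl truncnS_gt.
- move=> _ [x ->].
  transitivity (tail mu x)%:E; first by rewrite fineK// fin_num_measure.
  apply: esym.
  rewrite /= /pushforward/= /mrestr/=.
  (* To the left of 0 the preimage contains all of [0,1]; from 1 on it misses [0,1]. *)
  have [x0|x0] := ltP x 0.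
    rewrite (tail_lt0 x0) (_ : _ `&` _ = I).
      by rewrite /leb lebesgue_measure_itv/= lte01 oppr0 adde0.
    apply/seteqP; split=> t //=; first by move=> [].
    move=> It; split=> //; rewrite in_itv/= andbT (lt_le_trans x0)//.
    by move: It; rewrite /I/= -reflection_in in_itv/= => /andP[].
  have [x1|x1] := leP 1 x.
    rewrite (tail_ge1 x1) (_ : _ `&` _ = set0) ?measure0//.
    apply/seteqP; split=> t //= -[+ It]; rewrite in_itv/= andbT ltNge.
    move: It; rewrite /I/= -reflection_in in_itv/= => /andP[_ /le_trans].
    by move=> /(_ _ x1) ->.
  have xI : x \in `[0, 1] by rewrite in_itv/= x0 ltW.
  have phix : phi x = tail mu x by rewrite /phi/reflection xI.
  rewrite (_ : _ `&` _ = `[0, phi x[%classic).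
    rewrite /leb lebesgue_measure_itv/= oppr0 adde0 phix; case: ifPn => //.
    rewrite lte_fin -leNgt => ?; congr EFin; apply/eqP.
    by rewrite eq_le tail_ge0.
  apply/seteqP; split=> t /=; rewrite /I/= !in_itv/= andbT /phi.
    by rewrite gt_reflection => -[-> /andP[-> _]].
  move=> /andP[t0 tx]; rewrite gt_reflection; split=> //.
  by rewrite t0 (le_trans (ltW tx))// -/phi phix tail_le1.
- by move=> n; apply: (le_lt_trans (probability_le1 _ _)) => //; exact: ltry.
Qed.

Let phiK : involutive phi.
Proof. exact: reflection_involutive. Qed.

(** As [phi] preserves [0,1], the intersection disappears. Outside [0,1] the two sides differ: there
    [phi] is [1 - x] and the pushforward is Lebesgue measure, while [mu] vanishes. *)
Let mu_pushforward (A : set (measurableTypeR R)) : measurable A -> A `<=` I ->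
  mu A = pushforward leb phi A.
Proof.
move=> mA AI; rewrite (mu_reflection mA).
by rewrite /pushforward setIidl// => x /AI; rewrite /I/= reflection_in.
Qed.

Lemma ge0_integral_reflection (A : set (measurableTypeR R)) (k : R -> \bar R) :
  measurable A -> A `<=` `[0, 1] -> measurable_fun A k ->
  (forall x, (0 <= k x)%E) ->
  (\int[mu]_(x in A) k x = \int[leb]_(x in phi @^-1` A) k (phi x))%E.
Proof.
move=> mA AI mk k0.
rewrite (eq_measure_integral (pushforward leb phi)) => [|B mB BA]; last first.
  by apply: mu_pushforward => //; apply: subset_trans AI.
by rewrite ge0_integral_pushforward.
Qed.

Let restrict_phi (k : R -> R) : (k \o phi) \_ I = (k \_ I) \o phi.
Proof.
apply/funext => x; rewrite /= !patchE.
suff -> : (phi x \in I) = (x \in I) by [].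
by apply/idP/idP; rewrite !inE /I/= reflection_in.
Qed.

Lemma L2_reflection (k : R -> R) : L2 mu k -> L2 leb (k \o phi).
Proof.
move=> /L2P[mk k2]; apply/L2P; split.
  by rewrite restrict_phi; exact: measurableT_comp.
move: k2; rewrite ge0_integral_reflection => //.
- rewrite (_ : _ @^-1` _ = `[0%R, 1%R]%classic)//.
  by apply/seteqP; split=> x; rewrite /= reflection_in.
- exact/measurable_EFinP/measurable_funX/measurable_restrictT.
- by move=> x; rewrite lee_fin sqr_ge0.
Qed.

(** The same change of variables, from [mu] to Lebesgue measure, is applied to [k \o phi];
    involutivity then gives back [k]. *)
Lemma L2_reflectionV (k : R -> R) : L2 leb k -> L2 mu (k \o phi).
Proof.
move=> /L2P[mk k2].
have mkphi : measurable_fun [set: measurableTypeR R] ((k \o phi) \_ `[0, 1]).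
  by rewrite restrict_phi; exact: measurableT_comp.
apply/L2P; split=> //.
rewrite ge0_integral_reflection => //.
- rewrite (_ : _ @^-1` _ = `[0%R, 1%R]%classic)//.
    by under eq_integral do rewrite /= phiK.
  by apply/seteqP; split=> x; rewrite /= reflection_in.
- exact/measurable_EFinP/measurable_funX/measurable_restrictT.
- by move=> x; rewrite lee_fin sqr_ge0.
Qed.

Lemma Rintegral_reflection (A : set (measurableTypeR R)) (k : R -> R) :
  measurable A -> A `<=` `[0, 1] -> L2 mu k ->
  \int[mu]_(x in A) k x = \int[leb]_(x in phi @^-1` A) k (phi x).
Proof.
move=> mA AI k2; have /L2P[mk _] := k2.
have e x : x \in A -> k x = (k \_ I) x.
  by move=> /set_mem/AI xI; rewrite patchE mem_set.
(* [L2] gives measurability only for the extension of [k] by 0, so the pushforward formula is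
   applied to that extension. *)
transitivity (\int[mu]_(x in A) (k \_ I) x).
  by apply: eq_Rintegral => x /e.
transitivity (\int[leb]_(x in phi @^-1` A) (k \_ I) (phi x)); last first.
  by apply: eq_Rintegral => x xA; rewrite e// inE; move: xA; rewrite inE.
congr fine.
rewrite (@eq_measure_integral _ _ _ _ (pushforward leb phi) mu); last first.
  move=> B mB BA.
  by apply: mu_pushforward => //; apply: subset_trans AI.
rewrite integral_pushforward//; first exact/measurable_EFinP.
have AIphi : phi @^-1` A `<=` `[0, 1] by move=> x /AI; rewrite /= reflection_in.
rewrite (_ : _ \o _ = EFin \o ((k \o phi) \_ I)); last by rewrite restrict_phi.
apply: (@eq_integrable _ _ _ leb _ _ (EFin \o (k \o phi))).
- by rewrite -[_ @^-1` _]setTI; exact: mphi.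
- by move=> x /set_mem/AIphi xI; rewrite /= patchE mem_set.
apply: L2_integrableS => //; [exact: lebesgue_measure01_lty|exact: L2_reflection|].
by rewrite -[_ @^-1` _]setTI; exact: mphi.
Qed.

(** * Derivatives and eigenfunctions under the reflection *)

Let phi_le x y : (phi x <= y) = (phi y <= x).
Proof. exact: le_reflection. Qed.
Let phi_ge x y : (x <= phi y) = (y <= phi x).
Proof. exact: ge_reflection. Qed.
Let phi_gt x y : (x < phi y) = (y < phi x).
Proof. exact: gt_reflection. Qed.
Let phi0 : phi 0 = 1.
Proof. exact: reflection0. Qed.
Let phi1 : phi 1 = 0.
Proof. exact: reflection1. Qed.
Let phi_in x : (phi x \in `[0, 1]) = (x \in `[0, 1]).
Proof. exact: reflection_in. Qed.

Let mu01_lty : (mu `[0%R, 1%R]%classic < +oo)%E.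
Proof.
by apply: (@le_lt_trans _ _ 1%E); [exact: probability_le1 | exact: ltry].
Qed.

(** Since [f (phi 0) = f 1], the increment of [f \o phi] from 0 to [x] is minus the integral of [h]
    over []phi x, 1]]. The sign comes from the reversal of order. *)
Lemma is_derivative_wrt_reflection (f h : R -> R) : is_derivative_wrt mu f h ->
  is_derivative_wrt leb (f \o phi) (fun x => - h (phi x)).
Proof.
move=> fh; have [h2 fE] := fh.
have hphi2 : L2 leb (h \o phi) by exact: L2_reflection.
split.
  rewrite (_ : (fun _ => _) = (fun x => -1 * (h \o phi) x)); first exact: L2Z.
  by apply/funext => x; rewrite mulN1r.
move=> x x01; rewrite /= phi0.
have x01' : (0 <= x) && (x <= 1) by move: x01; rewrite in_itv.
have -> : f (phi x) = f 1 - \int[mu]_(t in `]phi x, 1]) h t.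
  rewrite -(is_derivative_wrt_tail mu01_lty fh) ?phi_in//.
  by rewrite opprB addrCA subrr addr0.
congr (_ + _).
rewrite (Rintegral_reflection _ _ h2)//; last first.
  move=> t /=; rewrite !in_itv/= => /andP[/ltW + ->].
  by rewrite andbT; apply: le_trans; move: x01; rewrite -phi_in in_itv/= => /andP[].
rewrite (_ : _ @^-1` _ = `[0, x[%classic); last first.
  by apply/seteqP; split=> t /=;
    rewrite !in_itv/= -/phi phi_gt phiK phi_le phi1 andbC.
have intx : leb.-integrable `[0, x] (EFin \o (h \o phi)).
  apply: L2_integrableS => //.
  - exact: lebesgue_measure01_lty.
  - by apply: subset_itvl; rewrite bnd_simp; case/andP: x01'.
(* The preimage is open at [x]; the missing endpoint is Lebesgue-null. *)
rewrite (@Rintegral_itv_bndo_bndc _ (BLeft 0) x (h \o phi)); last first.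
  by apply: integrableS intx => //; apply: subset_itvl; rewrite bnd_simp.
rewrite -mulN1r -RintegralZl//.
by apply: eq_Rintegral => t _; rewrite mulN1r.
Qed.

Lemma is_derivative_wrt_reflectionV (f h : R -> R) : is_derivative_wrt leb f h ->
  is_derivative_wrt mu (f \o phi) (fun x => - h (phi x)).
Proof.
move=> fh; have [h2 fE] := fh.
have hphi2 : L2 mu (h \o phi) by exact: L2_reflectionV.
split.
  rewrite (_ : (fun _ => _) = (fun x => -1 * (h \o phi) x)); first exact: L2Z.
  by apply/funext => x; rewrite mulN1r.
move=> x x01; rewrite /= phi0.
have /andP[x0 x1] : (0 <= x) && (x <= 1) by move: x01; rewrite in_itv.
have intx : mu.-integrable `[0, x] (EFin \o (h \o phi)).
  apply: L2_integrableS => //.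
  by apply: subset_itvl; rewrite bnd_simp.
have -> : \int[mu]_(t in `[0, x]) (- h (phi t)) =
    - \int[mu]_(t in `[0, x]) ((h \o phi) t).
  by rewrite -mulN1r -RintegralZl//; apply: eq_Rintegral => t _; rewrite mulN1r.
rewrite (Rintegral_reflection _ _ hphi2)//; last first.
  by apply: subset_itvl; rewrite bnd_simp.
rewrite (_ : _ @^-1` _ = `[phi x, 1]%classic); last first.
  by apply/seteqP; split=> t /=;
    rewrite !in_itv/= -/phi phi_ge phi0 phi_le andbC.
have -> : \int[leb]_(t in `[phi x, 1]) ((h \o phi) (phi t)) =
    \int[leb]_(t in `[phi x, 1]) h t.
  by apply: eq_Rintegral => t _; rewrite /= phiK.
(* The preimage of [[0, x]] is closed at [phi x], whereas [is_derivative_wrt_tail] wants it open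
   there. The endpoint is dropped under Lebesgue measure. *)
rewrite -Rintegral_itv_obnd_cbnd; last first.
  apply: L2_integrableS => //.
  - exact: lebesgue_measure01_lty.
  - move=> t /=; rewrite !in_itv/= => /andP[/ltW + ->].
    by rewrite andbT; apply: le_trans; move: x01; rewrite -phi_in in_itv/= => /andP[].
rewrite -(is_derivative_wrt_tail (@lebesgue_measure01_lty R) fh) ?phi_in//.
by rewrite opprB addrCA subrr addr0.
Qed.

Lemma eigenfunction_reflection (L : R) (f f' : R -> R) : 0 < L ->
  eigenfunction mu L f f' ->
  eigenfunction mu L (f' \o reflection mu) (fun x => L * f (reflection mu x)).
Proof.
move=> L0 [[x x01 fx0] [ff' _] f'f].
have gg' := is_derivative_wrt_reflection f'f.
have g'g := is_derivative_wrtZ L mu01_lty (is_derivative_wrt_reflectionV ff').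
have e1 : (fun y => - (- L * f (phi y))) = (fun y => L * f (phi y)).
  by apply/funext => y; rewrite mulNr opprK.
have e2 : (fun y => L * - f' (phi y)) = (fun y => - L * (f' \o phi) y).
  by apply/funext => y; rewrite mulNr mulrN.
rewrite e1 in gg'; rewrite e2 in g'g.
split=> //; last by split=> //; exists (fun y => - L * (f' \o reflection mu) y).
(* The new eigenfunction is non-zero: if [f'] vanished on [0,1], [f] would be constant, and
   integrating [- L * f] over [0,1] would give [L * f 0 = 0], hence [f = 0] because [L > 0]. *)
apply: contrapT => f'0.
have {}f'0 y : y \in `[0, 1] -> f' y = 0.
  move=> y01; apply/eqP/negPn/negP => f'y; apply: f'0.
  exists (reflection mu y); first by rewrite reflection_in.
  by rewrite /= reflection_involutive.
have fcst y : y \in `[0, 1] -> f y = f 0.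
  move=> y01; rewrite ff'.2// (@eq_Rintegral _ _ _ _ _ (cst 0)).
    by rewrite /Rintegral/= integral0 addr0.
  move=> t /set_mem/=; rewrite in_itv/= => /andP[t0 ty].
  apply: f'0; rewrite in_itv/= t0/= (le_trans ty)//.
  by move: y01; rewrite in_itv => /andP[].
have i0 : 0 \in `[0, (1:R)] by rewrite in_itv/= lexx ler01.
have i1 : 1 \in `[0, (1:R)] by rewrite in_itv/= lexx ler01.
have := f'f.2 _ i1; rewrite !f'0// add0r.
rewrite (@eq_Rintegral _ _ _ _ _ (cst (- L * f 0))).
  have m01 : measurable (`[0, 1]%classic : set (measurableTypeR R)).
    exact: measurable_itv.
  rewrite Rintegral_cst//.
  rewrite [X in fine X](_ : _ = 1%E); last exact: mu_ss.1.
  move=> /esym/eqP; rewrite mulr1 mulf_eq0 oppr_eq0 gt_eqF//= => /eqP f00.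
  by move: fx0; rewrite fcst// f00 eqxx.
by move=> t /set_mem t01; rewrite /= fcst.
Qed.

End self_similar_reflection.

(** * Exchange of iterated integrals over a triangle *)

Lemma integralZ_patch (d : measure_display) (T : measurableType d)
    (R : realType) (m : {measure set T -> \bar R}) (c : R) (A : set T) (k : T -> R) :
  measurable A -> m.-integrable A (EFin \o k) ->
  (\int[m]_x (c * (k \_ A) x)%:E)%E = (c * \int[m]_(x in A) k x)%:E.
Proof.
move=> mA ki.
transitivity (\int[m]_(x in A) (c * k x)%:E)%E.
  rewrite [RHS]integral_mkcond; apply: eq_integral => x _.
  by rewrite !patchE; case: ifPn; rewrite ?mulr0.
by rewrite EFinM fineK ?integrable_fin_num// -integralZl.
Qed.

Section triangle.
Context (R : realType).
Variables (m1 m2 : {sigma_finite_measure set (measurableTypeR R) -> \bar R}).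
Variables (h k : R -> R).
Let T := measurableTypeR R.
Let I : set T := `[0, 1]%classic.
Hypothesis hi : m1.-integrable I (EFin \o h).
Hypothesis ki : m2.-integrable I (EFin \o k).

Let mitv (i : interval R) : measurable ([set` i] : set T).
Proof. exact: measurable_itv. Qed.

Let H : T -> R := h \_ I.
Let K : T -> R := k \_ I.
Let P : set (T * T) := [set p | p.1 <= p.2].

Let Hi : m1.-integrable [set: T] (EFin \o H).
Proof.
rewrite /H -restrict_EFin.
exact: (iffLR (integrable_mkcond _ (mitv _))).
Qed.
Let Ki : m2.-integrable [set: T] (EFin \o K).
Proof.
rewrite /K -restrict_EFin.
exact: (iffLR (integrable_mkcond _ (mitv _))).
Qed.

Let mH : measurable_fun [set: T] H.
Proof. by apply/measurable_EFinP; exact: measurable_int Hi. Qed.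
Let mK : measurable_fun [set: T] K.
Proof. by apply/measurable_EFinP; exact: measurable_int Ki. Qed.

Let mP : measurable P.
Proof.
have := @measurable_fun_ler _ _ R setT _ _
  (@measurable_fst _ _ T T) (@measurable_snd _ _ T T).
by move=> /(_ measurableT [set true] Logic.I); rewrite setTI.
Qed.

Let Phi (p : T * T) : \bar R := (H p.1 * K p.2 * \1_P p)%:E.

Let mPhi : measurable_fun [set: T * T] Phi.
Proof.
apply/measurable_EFinP; apply: measurable_funM => //.
by apply: measurable_funM; apply: measurableT_comp.
Qed.

(** By Tonelli: [|Phi|] is at most [|H| * |K|], whose iterated integral is a product of two finite
    integrals. *)
Let Phi_integrable : (m1 \x m2)%E.-integrable [set: T * T] Phi.
Proof.
apply: (iffRL (@integrable12ltyP _ _ _ _ _ m1 m2 _ mPhi)).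
have mKn : measurable_fun [set: T] (fun y => `|K y|%:E).
  by apply/measurable_EFinP; exact: measurableT_comp.
have mHn : measurable_fun [set: T] (fun y => `|H y|%:E).
  by apply/measurable_EFinP; exact: measurableT_comp.
apply: (@le_lt_trans _ _ (\int[m1]_x (`|H x|%:E * \int[m2]_y `|K y|%:E))%E).
  apply: ge0_le_integral => //.
  - by move=> x _; exact: integral_ge0.
  - apply: (measurable_fun_fubini_tonelli_F (abse \o Phi)) => //=.
    exact: measurableT_comp.
  - exact: emeasurable_funM.
  - move=> x _; rewrite -ge0_integralZl//.
    apply: ge0_le_integral => //.
    + apply: (@measurableT_comp _ _ _ _ _ _ abse) => //.
      exact: (measurableT_comp mPhi (measurable_pair1 x)).
    + apply/measurable_EFinP; apply: measurable_funM => //.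
      exact: measurableT_comp.
    + move=> y _; rewrite /Phi/= -EFinM lee_fin !normrM ler_piMr//.
      by rewrite indicE; case: (_ \in _); rewrite ?normr1 ?normr0.
have [_ Kfin] := integrableP _ _ _ Ki.
have [_ Hfin] := integrableP _ _ _ Hi.
rewrite ge0_integralZr//; last exact: integral_ge0.
by rewrite lte_mul_pinfty// ?integral_ge0// ge0_fin_numE// integral_ge0.
Qed.

(** Plays the part of integration by parts for two measures. It is Fubini for [Phi], whose first
    variable is [t] and second [x]; the diagonal belongs to the triangle, so both inner intervals
    are closed. *)
Lemma Rintegral_triangle :
  \int[m2]_(x in I) (k x * \int[m1]_(t in `[0, x]) h t) =
  \int[m1]_(t in I) (h t * \int[m2]_(x in `[t, 1]) k x).
Proof.
have IE (t : R) : (t \in I) = (0 <= t <= 1) by rewrite mem_setE in_itv.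
have PE (t x : R) : ((t, x) \in P) = (t <= x) by apply/idP/idP; rewrite inE.
have inner1 t : (\int[m2]_x Phi (t, x) =
    ((fun t => h t * \int[m2]_(x in `[t, 1]) k x) \_ I t)%:E)%E.
  rewrite patchE; case: ifPn => tI; last first.
    rewrite integral0_eq// => x _.
    by rewrite /Phi/= /H patchE (negbTE tI) !mul0r.
  have t01 : 0 <= t <= 1 by rewrite -IE.
  rewrite -integralZ_patch//; last first.
    apply: integrableS ki => //; first exact: measurable_itv.
    by apply: subset_itvr; rewrite bnd_simp; case/andP: t01.
  apply: eq_integral => x _.
  rewrite /Phi/= /H patchE tI -mulrA; congr (_ * _)%:E.
  rewrite /K !patchE indicE PE IE !mem_setE !in_itv/=.
  case: ifPn => [/andP[x0 x1]|].
    by rewrite x1 andbT; case: ifPn; rewrite ?mulr1 ?mulr0.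
  rewrite mul0r; case: ifPn => // /andP[tx ->].
  by rewrite andbT (le_trans _ tx)//; case/andP: t01.
have inner2 x : (\int[m1]_t Phi (t, x) =
    ((fun x => k x * \int[m1]_(t in `[0, x]) h t) \_ I x)%:E)%E.
  rewrite patchE; case: ifPn => xI; last first.
    rewrite integral0_eq// => t _.
    by rewrite /Phi/= /K patchE (negbTE xI) mulr0 mul0r.
  have x01 : 0 <= x <= 1 by rewrite -IE.
  rewrite -integralZ_patch//; last first.
    apply: integrableS hi => //; first exact: measurable_itv.
    by apply: subset_itvl; rewrite bnd_simp; case/andP: x01.
  apply: eq_integral => t _.
  rewrite /Phi/= /K patchE xI mulrAC mulrC; congr (_ * _)%:E.
  rewrite /H !patchE indicE PE IE !mem_setE !in_itv/=.
  case: ifPn => [/andP[t0 t1]|].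
    by rewrite t0/=; case: ifPn; rewrite ?mulr1 ?mulr0.
  rewrite mul0r; case: ifPn => // /andP[-> tx].
  by rewrite (le_trans tx)//; case/andP: x01.
have := Fubini Phi_integrable.
under eq_integral do rewrite inner1.
under [in RHS]eq_integral do rewrite inner2.
move/(congr1 fine) => e.
by rewrite [LHS]Rintegral_mkcond [RHS]Rintegral_mkcond; exact: esym e.
Qed.

End triangle.

(** * Positivity of Dirichlet eigenvalues by the energy identity *)

Lemma dirichlet_eigenvalue_gt0 (R : realType)
    (mu : probability (measurableTypeR R) R) (L : R) :
  dirichlet_eigenvalue mu L -> 0 < L.
Proof.
move=> [f [f' [[[x x01 fx0] [ff' _] f'f] f0 f1]]].
have mu_fin : (mu `[0%R, 1%R]%classic < +oo)%E.
  by apply: (@le_lt_trans _ _ 1%E); [exact: probability_le1 | exact: ltry].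
have leb_fin := @lebesgue_measure01_lty R.
pose leb : {sigma_finite_measure set (measurableTypeR R) -> \bar R} :=
  lebesgue_measure.
pose I : set (measurableTypeR R) := `[0, 1]%classic.
have mI : measurable I by exact: measurable_itv.
have Ii : mu.-integrable I (EFin \o (fun x => - L * f x)).
  by apply: L2_integrable => //; exact: f'f.1.
have I'i : leb.-integrable I (EFin \o f').
  by apply: L2_integrable => //; exact: ff'.1.
have i1 : 1 \in `[0, (1:R)] by rewrite in_itv/= lexx ler01.
(* Both Dirichlet conditions enter here; the zero mean of [f'] will remove the constant [f' 0] from
   the energy. *)
have I'0 : \int[leb]_(x in I) f' x = 0.
  by have := ff'.2 _ i1; rewrite f0 f1 add0r => /esym.
have /L2P[mf' f'2] := ff'.1.
have mf'I : measurable_fun I f' by exact/measurable_restrictT.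
have f'2i : leb.-integrable I (EFin \o (fun x => f' x ^+ 2)).
  apply/integrableP; split; first exact/measurable_EFinP/measurable_funX.
  by under eq_integral do rewrite /= ger0_norm ?sqr_ge0//.
rewrite ltNge; apply/negP => L0.
(* The inner integral is [f' x - f' 0], so this side of the triangle identity is the energy of
   [f]. *)
have lhs : \int[leb]_(x in I) (f' x * \int[mu]_(t in `[0, x]) (- L * f t)) =
    \int[leb]_(x in I) (f' x ^+ 2).
  transitivity (\int[leb]_(x in I) (f' x ^+ 2 - f' 0 * f' x)).
    apply: eq_Rintegral => t /set_mem It.
    have -> : \int[mu]_(x in `[0, t]) (- L * f x) = f' t - f' 0.
      by rewrite (f'f.2 _ It) addrAC subrr add0r.
    by ring.
  rewrite RintegralB//.
    by rewrite RintegralZl// I'0 mulr0 subr0.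
  by apply: (integrableZl mI (f' 0) I'i).
(* As [f 1 = 0], the inner integral is [- f t] and the integrand is [L * f t ^+ 2], nonpositive
   under the assumption [L <= 0]. *)
have rhs : \int[mu]_(t in I) ((- L * f t) * \int[leb]_(x in `[t, 1]) f' x) <= 0.
  rewrite (_ : \int[mu]_(t in I) _ = \int[mu]_(t in I) (L * f t ^+ 2)).
    apply: fine_le0.
    rewrite (_ : (fun _ => _) = fun t => (- (- L * f t ^+ 2)%:E)%E); last first.
      by apply/funext => t; rewrite -EFinN mulNr opprK.
    have Lf2_ge0 t : (0 <= (- L * f t ^+ 2)%:E)%E.
      by rewrite lee_fin mulr_ge0 ?sqr_ge0// oppr_ge0.
    by rewrite integral_ge0N// oppe_le0; exact: integral_ge0.
  apply: eq_Rintegral => t /set_mem It.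
  have It0 : 0 <= t by move: It; rewrite /I/= in_itv => /andP[].
  rewrite -Rintegral_itv_obnd_cbnd; last first.
    apply: L2_integrableS => //; first exact: ff'.1.
    by move=> y /=; rewrite !in_itv/= => /andP[/ltW/(le_trans It0) -> ->].
  rewrite -(is_derivative_wrt_tail leb_fin ff') //.
  rewrite f1; ring.
have f'2_0 : (\int[leb]_(x in I) `|(f' x ^+ 2)%:E| = 0)%E.
  under eq_integral do rewrite gee0_abs ?lee_fin ?sqr_ge0//.
  rewrite -[LHS]fineK ?integrable_fin_num//; congr EFin.
  apply/eqP; rewrite eq_le; apply/andP; split; last first.
    by apply: Rintegral_ge0 => *; exact: sqr_ge0.
  by rewrite -[X in X <= _]lhs (Rintegral_triangle Ii I'i).
(* Zero energy gives [f' = 0] only almost everywhere, which is enough: [f x] is the integral of [f']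
   from 0, so it vanishes, against [fx0]. *)
have f'ae : ae_eq leb I (EFin \o f') (cst 0%E).
  have := (ae_eq_integral_abs leb mI (measurable_int _ f'2i)).1 f'2_0.
  apply: filterS => t /= tt It; have := tt It => /eqP.
  by rewrite eqe sqrf_eq0 => /eqP ->.
move: fx0; rewrite ff'.2// f0 add0r /Rintegral.
have [mx xI] : measurable (`[0, x]%classic : set (measurableTypeR R)) /\
    `[0, x]%classic `<=` I.
  split; first exact: measurable_itv.
  by apply: subset_itvl; rewrite bnd_simp; move: x01; rewrite in_itv => /andP[].
rewrite (@ae_eq_integral _ _ _ leb _ (cst 0%E))//.
- by rewrite integral0 eqxx.
- apply/measurable_EFinP; exact: measurable_funS mf'I.
- exact: ae_eq_subset f'ae.
Qed.

Theorem theorem9p1 (R : realType) (r1 r2 m1 m2 : R)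
    (r1_gt0 : 0 < r1) (r2_gt0 : 0 < r2) (m1_gt0 : 0 < m1) (m2_gt0 : 0 < m2)
    (m1Dm2 : m1 + m2 = 1) (r1E : r1 = m2) (r2E : r2 = m1)
    (mu : probability (measurableTypeR R) R)
    (mu_self_similar : self_similar r1 r2 m1 m2 mu) :
  [set L : R | 0 < L /\ neumann_eigenvalue mu L] =
  [set L : R | dirichlet_eigenvalue mu L].
Proof.
(* The reflection lemmas are used with ratios [m2], [m1], their weights then being [m1], [m2]. *)
subst r1 r2; have m2Dm1 : m2 + m1 = 1 by rewrite addrC.
have phi0 := reflection0 m2_gt0 m1_gt0 m2Dm1 mu_self_similar.
have phi1 := reflection1 m2_gt0 m1_gt0 m2Dm1 mu_self_similar.
have refl := eigenfunction_reflection m2_gt0 m1_gt0 m2Dm1 mu_self_similar.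
apply/seteqP; split=> L /=.
  move=> [L0 [f [f' [ff' f'0 f'1]]]].
  exists (f' \o reflection mu), (fun x => L * f (reflection mu x)).
  by split; [exact: refl | rewrite /= phi0 | rewrite /= phi1].
move=> L_dir; have L0 := dirichlet_eigenvalue_gt0 L_dir.
have [f [f' [ff' f0 f1]]] := L_dir; split=> //.
(* The same witness serves both directions: the reflection swaps 0 and 1, so the endpoint values of
   [f] become, up to the factor [L], those of the new derivative. *)
exists (f' \o reflection mu), (fun x => L * f (reflection mu x)).
by split; [exact: refl | rewrite phi0 f1 mulr0 | rewrite phi1 f0 mulr0].
Qed.
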